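(* (1) Let $R$ be a Prüfer domain with quotient field $K$, let $T$ be an overring of $R$, and let $\mathcal{A}=\{P\in \mathrm{Spec}(R)\mid PT\in \mathrm{Max}(T)\}$. Then $\mathcal{A}$ is compact. (2) If $R$ is a Prüfer domain which is not a $QR$-domain, then there exists a compact set of prime ideals of $R$ which does not have the P.A-property. (3) If $R$ is a $QR$-domain and $\mathcal{A}\subseteq \mathrm{Spec}(R)$, then $\mathcal{A}$ has the P.A-property if and only if $\mathcal{A}$ is compact.
   Context: All rings are commutative with $1\neq 0$. An overring of an integral domain $R$ with quotient field $K$ is a ring $T$ with $R\subseteq T\subseteq K$. An integral domain $D$ is a $QR$-domain if each overring of $D$ is a localization (ring of quotients) of $D$ with respect to a multiplicatively closed subset of $D$. $\mathrm{Max}(T)$ is the set of maximal ideals of $T$. A set $\mathcal{A}\subseteq \mathrm{Spec}(R)$ has the P.A-property (prime avoidance property) if whenever an ideal $I$ of $R$ satisfies $I\subseteq\bigcup_{P\in\mathcal{A}}P$, there exists $P\in\mathcal{A}$ with $I\subseteq P$. $\mathcal{A}$ carries the subspace topology of the Zariski topology on $\mathrm{Spec}(R)$; compact means every open cover has a finite subcover (no Hausdorff condition). *)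

(* Defs.v *)
From HB Require Import structures.
From mathcomp Require Import all_boot all_order all_algebra.
From mathcomp Require Import ring_quotient fraction.
From mathcomp Require Import all_classical topology.

Set Implicit Arguments.
Unset Strict Implicit.
Unset Printing Implicit Defensive.

Import GRing.Theory.

Local Open Scope classical_set_scope.
Local Open Scope ring_scope.

Section Spectrum.
Variable R : comNzRingType.

(* [prime_idealr] bundles a boolean predicate on R; classically this is no
   restriction, since every subset of R is the extension of such a predicate. *)
Definition Spec : Type := prime_idealr R.

HB.instance Definition _ := gen_eqMixin Spec.
HB.instance Definition _ := gen_choiceMixin Spec.

Definition zariski_locus (E : set R) : set Spec :=
  [set P : Spec | E `<=` [set` (P : prime_idealr R)]].

Definition zariski_open (U : set Spec) : Prop :=
  exists E : set R, U = ~` zariski_locus E.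

Lemma zariski_openT : zariski_open setT.
Proof.
exists setT; apply/seteqP; split=> // P _ /(_ 1 I) /=.
by rewrite (idealr1 (P : prime_idealr R)).
Qed.

Lemma zariski_openI : setI_closed zariski_open.
Proof.
move=> _ _ [E ->] [F ->].
exists [set x * y | x in E & y in F].
rewrite -setCU; congr (~` _); apply/seteqP; split=> P.
- case=> PE _ [x Ex [y Fy <-]] /=.
    by rewrite (prime_idealrM (P : prime_idealr R)) (PE _ Ex).
  by rewrite (prime_idealrM (P : prime_idealr R)) (PE _ Fy) orbT.
- move=> PEF; apply: contrapT => /not_orP [/existsNP [x /not_implyP [Ex Px]]].
  move=> /existsNP [y /not_implyP [Fy Py]].
  have /= := PEF (x * y) (ex_intro2 _ _ x Ex (ex_intro2 _ _ y Fy erefl)).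
  by rewrite (prime_idealrM (P : prime_idealr R)) => /orP [].
Qed.

Lemma zariski_open_bigU (I : Type) (f : I -> set Spec) :
  (forall i, zariski_open (f i)) -> zariski_open (\bigcup_i f i).
Proof.
move=> /choice [E fE]; exists (\bigcup_i E i).
rewrite (eq_bigcupr (fun i _ => fE i)) -setC_bigcap; congr (~` _).
apply/seteqP; split=> P.
- by move=> PE x [i _ Eix]; exact: (PE i).
- by move=> PE i _ x Eix; apply: PE; exists i.
Qed.

HB.instance Definition _ := isOpenTopological.Build Spec
  zariski_openT zariski_openI zariski_open_bigU.

End Spectrum.

Section Submodules.
Variable L : comNzRingType.

Definition submodule_over (B M : set L) : Prop :=
  [/\ M 0, forall x y, M x -> M y -> M (x + y)
    & forall b x, B b -> M x -> M (b * x)].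

(* Ideals of a subring B of L, not necessarily proper. *)
Definition ideal_of (B I : set L) : Prop := I `<=` B /\ submodule_over B I.

Definition maximal_ideal_of (B M : set L) : Prop :=
  [/\ ideal_of B M, M <> B
    & forall J, ideal_of B J -> M `<=` J -> J = M \/ J = B].

Definition mulset (I J : set L) : set L :=
  [set x | exists n (a b : 'I_n -> L),
     (forall i, I (a i) /\ J (b i)) /\ x = \sum_(i < n) a i * b i].

Definition ideal_gen (s : seq L) : set L :=
  range (fun c : 'I_(size s) -> L => \sum_(i < size s) c i * s`_i).

End Submodules.

Definition PA_property (R : comNzRingType) (A : set (Spec R)) : Prop :=
  forall I : set R, ideal_of [set: R] I ->
    I `<=` \bigcup_(P in A) [set` (P : prime_idealr R)] ->
    exists2 P : Spec R, A P & I `<=` [set` (P : prime_idealr R)].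

Section Overrings.
Variable R : idomainType.
Local Notation K := {fraction R}.
Local Notation tofrac := (@FracField.tofrac R : R -> K).

Definition fractional_ideal (J : set K) : Prop :=
  submodule_over (range tofrac) J /\
  exists2 d : R, d != 0 & forall x, J x -> range tofrac (tofrac d * x).

Definition invertible (I : set K) : Prop :=
  exists2 J : set K, fractional_ideal J & mulset I J = range tofrac.

(* Every nonzero finitely generated ideal is invertible (fields included). *)
Definition prufer_domain : Prop :=
  forall s : seq R, ideal_gen s <> [set 0] ->
    invertible (tofrac @` ideal_gen s).

Definition overring (T : set K) : Prop :=
  subring_closed [in T] /\ range tofrac `<=` T.

Definition localization (S : set R) : set K :=
  [set tofrac r / tofrac s | r in [set: R] & s in S].

(* 0 is excluded from S: the localization would otherwise be the zero ring. *)
Definition qr_domain : Prop :=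
  forall T : set K, overring T ->
    exists S : set R, [/\ mulr_closed [in S], ~ S 0 & T = localization S].

Definition extension (T : set K) (P : Spec R) : set K :=
  mulset (tofrac @` [set` (P : prime_idealr R)]) T.

End Overrings.

(* Main.v *)
Require Import Defs.
From HB Require Import structures.
From mathcomp Require Import all_boot all_order all_algebra.
From mathcomp Require Import ring_quotient fraction.
From mathcomp Require Import all_classical topology.

(** Everything rests on one property of R, [comaximal_denominators]: every x in
    K admits p, q in R with p x and q x in R and p x + q = 1.

    A Prüfer domain has it: for x = a / b, write 1 = u a + v b with u and v in
    the inverse of (a, b), and take p = u b and q = v b.  Given this property, a
    maximal ideal M of an overring T is generated by P = M ∩ R, because
    x = (p x) x + q x exhibits x in M as a combination of p x, q x in P.  So the
    set A of primes P with PT maximal is a copy of Max(T).  It is compact because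
    a subset E of R contained in no member of A generates the unit ideal of T,
    and finitely many elements of E already do.

    If such an A has prime avoidance, then T is the ring of quotients of R with
    respect to S, the complement of the union of A: elements of S lie in no
    maximal ideal of T, hence are units there; and for x in T the ideal of
    denominators of x contains p and q, so lies in no member of A, so by prime
    avoidance meets S.  A Prüfer domain that is not QR has an overring for which
    this fails, and the corresponding A is compact without prime avoidance.

    Prime avoidance implies compactness in every ring: apply it to the ideal
    generated by a set E contained in no member of A; a single element outside
    all of A involves finitely many elements of E.  For the converse in a
    QR-domain, compactness replaces an ideal I contained in no member of A by
    finitely many of its elements, and these have the same radical as one
    element of the ideal they generate ([qr_radical_principal]); that element
    of I lies in no member of A.

    The radical statement is obtained for two elements a, b from the overring
    T = R_a ∩ R_b.  By [comaximal_denominators], a and b generate the unit ideal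
    of T; T being a ring of quotients R_S, clearing denominators gives s in S
    with s in (a, b), and 1/s in T says that s divides powers of a and of b.
    That a QR-domain has [comaximal_denominators] is a valuation argument.  If
    the property fails at x, some prime P contains all denominators of x and of
    1/x, and since R[x] and R[1/x] are rings of quotients, some element of P is
    inverted in each.  This makes 1 an element of PR[x] and of PR[1/x], which
    the minimal degree argument of the valuation existence theorem excludes. *)

Set Implicit Arguments.
Unset Strict Implicit.
Unset Printing Implicit Defensive.

Import GRing.Theory.

Local Open Scope classical_set_scope.
Local Open Scope ring_scope.

(** * Ideals of a subring *)

Lemma subring_setT (L : comNzRingType) : subring_closed [in [set: L]].
Proof. by split=> [|x y _ _|x y _ _]; rewrite inE. Qed.

Section Ideals.
Variables (L : comNzRingType) (B : set L).
Hypothesis ringB : subring_closed [in B].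
Implicit Types (E I J M : set L).

Lemma subring1 : B 1.
Proof. by case: ringB => + _ _; rewrite inE. Qed.

Lemma subringB x y : B x -> B y -> B (x - y).
Proof. by case: ringB => _ + _ => /(_ x y); rewrite !inE. Qed.

Lemma subringM x y : B x -> B y -> B (x * y).
Proof. by case: ringB => _ _ /(_ x y); rewrite !inE. Qed.

Lemma subring0 : B 0.
Proof. by rewrite -(subrr 1); exact: subringB subring1 subring1. Qed.

Lemma subringN x : B x -> B (- x).
Proof. by rewrite -sub0r; exact: subringB subring0. Qed.

Lemma subringD x y : B x -> B y -> B (x + y).
Proof. by move=> Bx /subringN By; rewrite -[y]opprK; exact: subringB. Qed.

Lemma submodule_sum M n (F : 'I_n -> L) :
  submodule_over B M -> (forall i, M (F i)) -> M (\sum_(i < n) F i).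
Proof. by case=> M0 MD _ MF; apply: (big_ind M) => // i _; exact: MF. Qed.

(** As [mulset E B] consists of the B-linear combinations of elements of E, it is
    the ideal of B generated by E when E is contained in B; this is the minimality
    that goes with [mem_mulset] and [mulset_submodule]. *)
Lemma mulset_min E M : submodule_over B M -> E `<=` M -> mulset E B `<=` M.
Proof.
move=> modM EM _ [n [a [b [ab ->]]]]; apply: submodule_sum => // i.
by have [/EM Ma Bb] := ab i; rewrite mulrC; case: modM => _ _; exact.
Qed.

Lemma mem_mulset E x : E x -> mulset E B x.
Proof.
move=> Ex; exists 1%N, (fun=> x), (fun=> 1).
by split=> [i|]; [split=> //; exact: subring1 | rewrite big_ord1 mulr1].
Qed.

Lemma mulset_submodule E : submodule_over B (mulset E B).
Proof.
split=> [|x y [m [a [b [ab ->]]]] [n [c [d [cd ->]]]]|t _ Bt [n [a [b [ab ->]]]]].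
- by exists 0%N, (fun=> 0), (fun=> 0); split=> [[]//|]; rewrite big_ord0.
- pose F T (u : 'I_m -> T) (v : 'I_n -> T) (i : 'I_(m + n)) :=
    match fintype.split i with inl j => u j | inr j => v j end.
  exists (m + n)%N, (F _ a c), (F _ b d); split=> [i|].
    by rewrite /F; case: fintype.split.
  rewrite big_split_ord; congr (_ + _); apply: eq_bigr => i _.
    by rewrite /F -[lshift n i]/(unsplit (inl i)) unsplitK.
  by rewrite /F -[rshift m i]/(unsplit (inr i)) unsplitK.
- exists n, a, (fun i => t * b i); split=> [i|].
    by have [Ea Bb] := ab i; split=> //; exact: subringM.
  by rewrite big_distrr; apply: eq_bigr => i _ /=; rewrite mulrCA.
Qed.

Lemma mulset_ideal E : E `<=` B -> ideal_of B (mulset E B).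
Proof.
move=> EB; split; last exact: mulset_submodule.
by apply: mulset_min EB; split; [exact: subring0|exact: subringD|exact: subringM].
Qed.

Lemma ideal1 I : ideal_of B I -> I 1 -> I = B.
Proof.
move=> [IB [_ _ IM]] I1; apply/seteqP; split=> // x Bx.
by rewrite -[x]mulr1; exact: IM.
Qed.

(** Zorn's lemma, applied to the sets X for which I ∪ X is a proper ideal: unlike
    the proper ideals containing I, these admit the union of the empty chain. *)
Lemma exists_maximal_ideal I : ideal_of B I -> ~ I 1 ->
  exists2 M, maximal_ideal_of B M & I `<=` M.
Proof.
move=> idI I1.
pose P (X : set L) := ideal_of B (I `|` X) /\ ~ (I `|` X) 1.
have [F FP totF|M [[idM M1] maxM]] := @Zorn_bigcup L P.
  have [->|/set0P[X0 FX0]] := eqVneq F set0.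
    by rewrite bigcup_set0 /P setU0.
  rewrite /P; split; last first.
    by move=> [/I1//|[X FX X1]]; have [_] := FP X FX; apply; right.
  (* two elements of the union already lie in a common member of the chain *)
  have common x y : (I `|` \bigcup_(X in F) X) x -> (I `|` \bigcup_(X in F) X) y ->
      exists2 X, F X & (I `|` X) x /\ (I `|` X) y.
    move=> [Ix|[X FX Xx]] [Iy|[Y FY Yy]].
    - by exists X0 => //; split; left.
    - by exists Y => //; split; [left|right].
    - by exists X => //; split; [right|left].
    - have [XY|YX] := totF X Y FX FY.
        by exists Y => //; split; right=> //; exact: XY.
      by exists X => //; split; right=> //; exact: YX.
  have sub X x : F X -> (I `|` X) x -> (I `|` \bigcup_(X in F) X) x.
    by move=> FX [|Xx]; [left|right; exists X].
  split=> [x [|[X FX Xx]]|].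
  - by case: idI => + _; exact.
  - by have [[+ _] _] := FP X FX; apply; right.
  split=> [|x y Ix /(common _ _ Ix)[X FX [{}Ix Iy]]|b x Bb Ix].
  - by left; case: idI => _ [].
  - by apply: (sub X) => //; have [[_ [_ + _]] _] := FP X FX; exact.
  - have [X FX [Xx _]] := common x x Ix Ix.
    by apply: (sub X) => //; have [[_ [_ _ +]] _] := FP X FX; exact.
exists (I `|` M); last exact: subsetUl.
split=> // [E|J idJ IMJ].
  by apply: M1; rewrite E; exact: subring1.
have [J1|J1] := pselect (J 1); first by right; exact: ideal1.
left; apply/seteqP; split=> // x Jx; apply: contrapT => Mx.
have := maxM J; apply.
  split=> [y My|/(_ x Jx) Mx'].
    by apply: IMJ; right.
  by apply: Mx; right.
rewrite /P; have -> : I `|` J = J by apply/setUidPr => y Iy; apply: IMJ; left.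
by split.
Qed.

Lemma maximal_ideal1 M : maximal_ideal_of B M -> ~ M 1.
Proof. by case=> idM MB _ /(ideal1 idM). Qed.

Lemma maximal_ideal_prime M x y : maximal_ideal_of B M ->
  B x -> B y -> M (x * y) -> M x \/ M y.
Proof.
move=> maxM Bx By Mxy; apply: contrapT => /not_orP[Mx My].
(* if x is not in M, then x and M generate B; as x y is in M, y multiplies both
   x and M, hence all of B, into M *)
have [[MB [M0 MD MM]] _ /(_ (mulset (x |` M) B))] := maxM.
case=> [||E|E].
- by apply: mulset_ideal => z [->|/MB].
- by move=> z Mz; apply: mem_mulset; right.
- by apply: Mx; rewrite -E; apply: mem_mulset; left.
- have : mulset (x |` M) B 1 by rewrite E; exact: subring1.
  move=> /(@mulset_min _ [set z | B z /\ M (z * y)]) [||_].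
  + split=> [|a b [Ba Ma] [Bb Mb]|b a Bb [Ba Ma]].
    * by split; [exact: subring0|rewrite mul0r].
    * by split; [exact: subringD|rewrite mulrDl; exact: MD].
    * by split; [exact: subringM|rewrite -mulrA; exact: MM].
  + move=> z [->|Mz]; split=> //; first exact: MB.
    by rewrite mulrC; exact: MM.
  + by rewrite mul1r.
Qed.

Lemma contraction_maximal_ideal (R : comNzRingType) (phi : {rmorphism R -> L}) M :
  range phi `<=` B -> maximal_ideal_of B M ->
  exists P : Spec R, forall r, (r \in (P : prime_idealr R)) <-> M (phi r).
Proof.
move=> phiB maxM; have [[MB [M0 MD MM]] _ _] := maxM.
have Bphi r : B (phi r) by apply: phiB; exists r.
pose S : R -> bool := fun r => `[< M (phi r) >].
have SP r : reflect (M (phi r)) (r \in S) by exact: asboolP.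
have idS : idealr_closed S.
  split=> [||a u v /SP Mu /SP Mv]; apply/SP.
  - by rewrite rmorph0.
  - by rewrite rmorph1; exact: maximal_ideal1.
  - by rewrite rmorphD rmorphM; apply: MD => //; exact: MM.
have primeS : prime_idealr_closed S.
  move=> u v /SP; rewrite rmorphM => /(maximal_ideal_prime maxM).
  by case=> // Mx; apply/orP; [left|right]; apply/SP.
pose i1 := isIdealr.Build R S idS.
pose i2 := isPrimeIdealrClosed.Build R S primeS.
pose P : prime_idealr R := HB.pack S i1 i2.
by exists P => r; split=> /SP.
Qed.

Lemma mulset_finite (R : comNzRingType) (phi : R -> L) (E : set R) x :
  mulset [set phi r | r in E] B x ->
  exists2 s : seq R, (forall r, r \in s -> E r)
    & mulset [set phi r | r in [set` s]] B x.
Proof.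
move=> [n [a [b [ab ->]]]].
have /choice[c cP] i : exists r, E r /\ phi r = a i.
  by have [[r Er <-] _] := ab i; exists r.
exists [seq c i | i <- enum 'I_n] => [r /mapP[i _ ->]|]; first by have [] := cP i.
exists n, a, b; split=> // i; have [_ <-] := cP i; have [_ Bb] := ab i.
by split=> //; exists (c i) => //=; rewrite map_f ?mem_enum.
Qed.

End Ideals.

(** * Compact sets of primes *)

Section Compactness.
Variable R : comNzRingType.
Implicit Types (P : Spec R) (A : set (Spec R)).

(** The open sets are the complements of the loci V(E), so a cover of A amounts to
    a set E, the union of the sets defining its members, contained in no prime
    of A; splitting E into singletons refines the cover into basic open sets. *)
Lemma cover_compactP A : cover_compact A <->
  forall E : set R, (forall P, A P -> ~ zariski_locus E P) ->
    exists2 s : seq R, (forall x, x \in s -> E x)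
      & forall P, A P -> exists2 x, x \in s & x \notin (P : prime_idealr R).
Proof.
split=> [cA E AE|cA I D f fo Af].
  have [||D' D'E AD'] := cA _ E (fun x => ~` zariski_locus [set x]).
  - by move=> x _; exists [set x].
  - move=> P /AE/existsNP[x /not_implyP[Ex Px]].
    by exists x => // xP; apply: Px; exact: xP.
  exists (finmap.enum_fset D') => [x xD'|P /AD'[x xD' Px]].
    by have := D'E x xD'; rewrite inE.
  exists x => //; apply/negP => xP; apply: Px => _ -> /=; exact: xP.
have {fo}/choice[E fE] i : exists E, D i -> f i = ~` zariski_locus E.
  have [Di|nDi] := pselect (D i); last by exists set0.
  by have [E fE] := fo i Di; exists E.
have [|s sE As] := cA (\bigcup_(i in D) E i).
  move=> P /Af[i Di]; rewrite (fE i Di) => nEP EP; apply: nEP => x Eix.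
  by apply: EP; exists i.
have {sE} [l lD sl] : exists2 l : seq I, (forall i, i \in l -> D i)
    & forall x, x \in s -> exists2 i, i \in l & E i x.
  elim: s sE {As} => [|x s IHs] sE; first by exists [::].
  have [y ys|l lD sl] := IHs; first by apply: sE; rewrite inE ys orbT.
  have [i Di Eix] := sE x (mem_head _ _).
  exists (i :: l) => [j|y]; rewrite inE => /predU1P[->//|]; first exact: lD.
    by exists i => //; exact: mem_head.
  by move=> /sl[j jl Ejy]; exists j => //; rewrite inE jl orbT.
exists (finmap.seq_fset tt l) => [i|P /As[x /sl[i il Eix] xP]].
  by rewrite finmap.seq_fsetE => /lD; rewrite inE.
exists i; first by have /= -> := finmap.seq_fsetE tt l i.
by rewrite (fE _ (lD _ il)) => /(_ x Eix); exact/negP.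
Qed.

End Compactness.

(** * Comaximal denominators and overrings *)

Section Fractions.
Variable R : idomainType.
Local Notation K := {fraction R}.
Local Notation "x %:F" := (@FracField.tofrac R x).
Implicit Types (P : Spec R) (x : K) (T : set K).

Lemma fraction_div x : exists2 ab : R * R, ab.2 != 0 & x = ab.1%:F / ab.2%:F.
Proof.
elim/quotW: x => -[[a b] /= b0]; exists (a, b) => //=.
apply/eqP; rewrite -[_ == _](inj_eq (mulIf (_ : b%:F != 0))) ?tofrac_eq0 //.
rewrite mulfVK ?tofrac_eq0 //; apply/eqP.
unlock FracField.tofrac.
rewrite -[LHS]FracField.pi_mul; apply/eqmodP; apply/eqP => /=.
rewrite /FracField.mulf /= !numden_Ratio ?oner_eq0 ?mulr1 //.
by rewrite mulrC.
Qed.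

(** The relation p x + q = 1 is recorded as p x = 1 - q, which also says that p x
    is in R. *)
Definition comaximal_denominators : Prop :=
  forall x, exists p q r : R, p%:F * x = (1 - q)%:F /\ q%:F * x = r%:F.

(** With x = a / b and (a, b) invertible, 1 = Σ (c_i a + d_i b) v_i where all the
    products a v_i, b v_i lie in R; then p = Σ c_i b v_i and q = Σ d_i b v_i. *)
Lemma prufer_comaximal_denominators :
  prufer_domain R -> comaximal_denominators.
Proof.
move=> prR x; have [[a b] /= b0 ->] := fraction_div x.
set I := ideal_gen [:: a; b].
have genI (c d : R) : I (c * a + d * b).
  exists (fun i : 'I_2 => if i == ord0 then c else d) => //.
  by rewrite !big_ord_recl big_ord0 addr0.
have Ia : I a by rewrite -[a]mul1r -[1 * a]addr0 -(mul0r b).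
have Ib : I b by rewrite -[b]mul1r -[1 * b]add0r -(mul0r a).
have [|J _ /seteqP[IJ JI]] := prR [:: a; b].
  by move=> E; move: Ib; rewrite /I E => /eqP; exact/negP.
have IJ_R u v : I u -> J v -> range (@FracField.tofrac R) (u%:F * v).
  move=> Iu Jv; apply: IJ; exists 1%N, (fun=> u%:F), (fun=> v).
  by split; [move=> _; split=> //; exists u|rewrite big_ord1].
have [n [u [v [uv E1]]]] : mulset [set i%:F | i in I] J 1.
  by apply: JI; exists 1 => //; exact: tofrac1.
(* [w i] packs ((c_i, d_i), (a v_i, b v_i)) *)
have {uv}/choice[w wP] i : exists w : (R * R) * (R * R),
    [/\ u i = (w.1.1 * a + w.1.2 * b)%:F, w.2.1%:F = a%:F * v i
      & w.2.2%:F = b%:F * v i].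
  have [[_ [c _ <-] <-] Jv] := uv i.
  have [[al _ alE] [be _ beE]] := (IJ_R _ _ Ia Jv, IJ_R _ _ Ib Jv).
  exists ((c ord0, c (lift ord0 ord0)), (al, be)); split=> //.
  by rewrite /= !big_ord_recl big_ord0 addr0.
have wx i : (w i).2.2%:F * (a%:F / b%:F) = (w i).2.1%:F.
  by have [_ -> ->] := wP i; rewrite mulrC mulrA divfK // tofrac_eq0.
exists (\sum_i (w i).1.1 * (w i).2.2), (\sum_i (w i).1.2 * (w i).2.2),
  (\sum_i (w i).1.2 * (w i).2.1).
split; last first.
  rewrite !rmorph_sum mulr_suml; apply: eq_bigr => i _.
  by rewrite !rmorphM -mulrA wx.
rewrite rmorphB rmorph1 E1; apply/eqP; rewrite -subr_eq0 opprB; apply/eqP.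
rewrite !rmorph_sum mulr_suml addrCA -sumrB -big_split big1 // => i _ /=.
have [-> _ bE] := wP i.
rewrite !rmorphM -mulrA wx rmorphD !rmorphM mulrDl -!mulrA -bE.
by have [_ -> _] := wP i; rewrite addrA [X in X - _]addrC subrr.
Qed.


Lemma overring_subring T : overring T -> subring_closed [in T].
Proof. by case. Qed.

Lemma overring_base T r : overring T -> T r%:F.
Proof. by case=> _; apply; exists r. Qed.

(** An x in M equals (p x) x + q x, and p x, q x belong to M ∩ R. *)
Lemma extension_contraction T M : comaximal_denominators -> overring T ->
  maximal_ideal_of T M ->
  exists2 P, (forall r, (r \in (P : prime_idealr R)) <-> M r%:F)
    & extension T P = M.
Proof.
move=> cmR ovT maxM; have ringT := overring_subring ovT.
have [P PM] : exists P, forall r, (r \in (P : prime_idealr R)) <-> M r%:F.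
  exact: (contraction_maximal_ideal ringT (phi := @FracField.tofrac R) ovT.2 maxM).
have [[MT modM] _ _] := maxM.
exists P => //; apply/seteqP; split=> [|x Mx].
  by apply: mulset_min => // _ [r /= /PM Mr <-].
have [p [q [r [px qx]]]] := cmR x.
have [_ eD eM] := mulset_submodule ringT [set r%:F | r in [set` (P : prime_idealr R)]].
have -> : x = x * (1 - q)%:F + 1 * r%:F.
  by rewrite -qx mulrC mul1r -mulrDl -rmorphD subrK rmorph1 mul1r.
have [_ _ MM] := modM.
apply: eD; (apply: eM; [|apply: (mem_mulset ringT)]).
- exact: MT.
- by exists (1 - q) => //; apply/PM; rewrite -px; apply: MM => //; exact: overring_base.
- exact: subring1.
- by exists r => //; apply/PM; rewrite -qx; apply: MM => //; exact: overring_base.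
Qed.

(** The primes in question are the contractions of the maximal ideals of T, and
    quasi-compactness of Max(T) comes from the finiteness of the expressions of 1
    as a combination. *)
Lemma contracted_maximal_compact T : comaximal_denominators -> overring T ->
  cover_compact [set P : Spec R | maximal_ideal_of T (extension T P)].
Proof.
move=> cmR ovT; have ringT := overring_subring ovT.
apply/cover_compactP => E EA.
have ET : [set r%:F | r in E] `<=` T by move=> _ [r _ <-]; exact: overring_base.
have [/mulset_finite[s sE s1]|E1] := pselect (mulset [set r%:F | r in E] T 1).
  exists s => // P /maximal_ideal1 eP1; apply: contrapT => sP; apply: eP1.
  apply: mulset_min s1; first exact: mulset_submodule.
  move=> _ [x /= xs <-]; apply: (mem_mulset ringT); exists x => //=.
  by apply: contrapT => /negP xP; apply: sP; exists x.
have [M maxM EM] := exists_maximal_ideal ringT (mulset_ideal ringT ET) E1.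
have [P PM eP] := extension_contraction cmR ovT maxM.
have [] := EA P; first by rewrite /= eP.
by move=> x Ex /=; apply/PM; apply: EM; apply: (mem_mulset ringT); exists x.
Qed.

(** T is the ring of quotients for the complement S of the union of the primes
    with maximal extension.  Prime avoidance is applied, for x in T, to the ideal
    of all s in R with s x in R: it extends to the unit ideal of T. *)
Lemma PA_property_localization T : comaximal_denominators -> overring T ->
  PA_property [set P : Spec R | maximal_ideal_of T (extension T P)] ->
  exists S : set R, [/\ mulr_closed [in S], ~ S 0 & T = localization S].
Proof.
move=> cmR ovT paA; have ringT := overring_subring ovT.
set A := [set P : Spec R | _] in paA.
pose S : set R := [set s | forall P, A P -> s \notin (P : prime_idealr R)].
have A_ext I : ideal_of T I -> ~ I 1 ->
    exists2 P, A P & forall r, I r%:F -> r \in (P : prime_idealr R).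
  move=> /(exists_maximal_ideal ringT)/[apply] -[M maxM IM].
  have [P PM eP] := extension_contraction cmR ovT maxM.
  by exists P; [rewrite /A /= eP | move=> r /IM/PM].
(* T has a maximal ideal, so there is at least one prime to contain 0 *)
have S0 : ~ S 0.
  move=> S0; have [||P AP _] := A_ext [set 0]; last first.
  - by have := S0 P AP; rewrite (idealr0 (P : prime_idealr R)).
  - by move=> /eqP; rewrite oner_eq0.
  split=> [_ ->|]; first exact: subring0.
  split=> [//|_ _ -> ->|b _ _ ->]; first by rewrite addr0.
  by rewrite mulr0.
exists S; split=> //.
- split=> [|x y]; rewrite !inE.
    by move=> P _; rewrite (idealr1 (P : prime_idealr R)).
  by move=> Sx Sy P AP; rewrite (prime_idealrM (P : prime_idealr R)) negb_or Sx ?Sy.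
apply/seteqP; split=> [x Tx|_ [r _ [s Ss <-]]].
  pose I : set R := [set s | range (@FracField.tofrac R) (s%:F * x)].
  have idI : ideal_of setT I.
    split=> //; split=> [|s t [u _ su] [v _ tv]|b s _ [u _ su]].
    - by exists 0 => //; rewrite rmorph0 mul0r.
    - by exists (u + v) => //; rewrite !tofracD mulrDl su tv.
    - by exists (b * u) => //; rewrite !tofracM su mulrA.
  have [] := pselect (I `<=` \bigcup_(P in A) [set` (P : prime_idealr R)]).
    move=> /(paA I idI)[P /maximal_ideal1 eP1 IP]; case: eP1.
    have [p [q [r [px qx]]]] := cmR x.
    have [_ eD eM] := mulset_submodule ringT
      [set r%:F | r in [set` (P : prime_idealr R)]].
    have -> : 1 = x * p%:F + 1 * q%:F.
      by rewrite mulrC px mul1r -rmorphD subrK rmorph1.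
    apply: eD; (apply: eM; [|apply: (mem_mulset ringT)]) => //.
    - by exists p => //; apply: IP; exists (1 - q).
    - exact: subring1.
    - by exists q => //; apply: IP; exists r.
  move=> /existsNP[s /not_implyP[[r _ rE] sA]].
  have Ss : S s by move=> P AP; apply/negP => sP; apply: sA; exists P.
  have s0 : s%:F != 0.
    by rewrite tofrac_eq0; apply/eqP => s0; apply: S0; rewrite -s0.
  by exists r => //; exists s => //; rewrite rE mulrC mulKf.
(* s lies in no maximal ideal of T, so it is a unit of T *)
apply: (subringM ringT); first exact: overring_base.
have [s0|s0] := eqVneq s 0.
  by rewrite s0 rmorph0 invr0; exact: subring0.
pose I := mulset [set s%:F] T.
have idI : ideal_of T I by apply: (mulset_ideal ringT) => _ ->; exact: overring_base.
have [I1|/(A_ext I idI)[P AP /(_ s)]] := pselect (I 1); last first.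
  by move=> /(_ (mem_mulset ringT erefl)) sP; have := Ss P AP; rewrite sP.
have : [set y | T (s%:F^-1 * y)] 1; last by rewrite /= mulr1.
apply: mulset_min I1 => [|_ ->] /=; last first.
  by rewrite mulVf ?tofrac_eq0 //; exact: subring1.
split=> [|y z Ty Tz|t y Tt Ty] /=.
- by rewrite mulr0; exact: subring0.
- by rewrite mulrDr; exact: subringD.
- by rewrite mulrCA; exact: subringM.
Qed.

(** * QR-domains have comaximal denominators *)

Local Notation ev x f := ((map_poly (@FracField.tofrac R) f).[x]).

Lemma horner_frac_poly n (E : nat -> R) x :
  ev x (\poly_(i < n) E i) = \sum_(i < n) (E i)%:F * x ^+ i.
Proof.
rewrite poly_def rmorph_sum horner_sum; apply: eq_bigr => i _ /=.
by rewrite map_polyZ hornerZ rmorphXn /= map_polyX hornerXn.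
Qed.

Lemma horner_frac_rev n (E : nat -> R) x : x != 0 ->
  ev x (\poly_(i < n.+1) E (n - i)%N) = x ^+ n * ev x^-1 (\poly_(i < n.+1) E i).
Proof.
move=> x0; rewrite !horner_frac_poly mulr_sumr (reindex_inj rev_ord_inj) /=.
apply: eq_bigr => i _; rewrite subSS; have le_in : (i <= n)%N by rewrite -ltnS.
by rewrite subKn // exprVn mulrCA -expfB_cond // (negPf x0).
Qed.

(** The key step of the existence theorem for valuation rings, in the form that
    1 cannot be in both PR[x] and PR[1/x]: the relations f(x) = 0 and g(1/x) = 0
    say so after localization at P.  The reversal h of g also vanishes at x and
    has leading coefficient g_0, so when deg g <= deg f, g_0 f minus a multiple of
    h by an element of P has smaller degree than f; it is congruent to g_0 f modulo P,
    hence still satisfies the hypotheses, and infinite descent concludes.  The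
    other case is symmetric under exchanging x and 1/x. *)
Lemma no_dual_roots P x f g : x != 0 ->
  ev x f = 0 -> ev x^-1 g = 0 ->
  f`_0 \notin (P : prime_idealr R) ->
  (forall i, (0 < i)%N -> f`_i \in (P : prime_idealr R)) ->
  g`_0 \notin (P : prime_idealr R) ->
  (forall i, (0 < i)%N -> g`_i \in (P : prime_idealr R)) ->
  False.
Proof.
have [n] := ubnP (size f + size g)%N; elim: n x f g => // n IHn x f g.
wlog le_gf : x f g / (size g <= size f)%N => [Hwlog|].
  have [le_gf|/ltnW le_fg] := leqP (size g) (size f); first exact: Hwlog.
  move=> szn x0 fx gx f0 fP g0 gP.
  apply: (Hwlog x^-1 g f) => //; first by rewrite addnC.
    by rewrite invr_eq0.
  by rewrite invrK.
rewrite ltnS => szn x0 fx gx f0 fP g0 gP.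
have coef0_size (h : {poly R}) : h`_0 \notin (P : prime_idealr R) -> (0 < size h)%N.
  apply: contraR; rewrite -eqn0Ngt size_poly_eq0 => /eqP->.
  by rewrite coef0 (idealr0 (P : prime_idealr R)).
have [ng szg] : exists ng, size g = ng.+1.
  by case: (size g) (coef0_size g g0) => // ng _; exists ng.
have [nf szf] : exists nf, size f = nf.+1.
  by case: (size f) (coef0_size f f0) => // nf _; exists nf.
rewrite szf szg ltnS in le_gf; rewrite szf szg in szn.
(* a nonzero constant has no root; so the leading coefficient of f is in P *)
have nf_gt0 : (0 < nf)%N.
  rewrite lt0n; apply/eqP => nf0; move: szf f0 fx; rewrite nf0.
  move=> /eqP/size_poly1P[c c0 ->] _ /eqP.
  by rewrite map_polyC hornerC tofrac_eq0 (negPf c0).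
pose h := \poly_(i < ng.+1) g`_(ng - i).
have hx : ev x h = 0.
  by rewrite /h horner_frac_rev // -szg coefK gx mulr0.
pose f' := g`_0 *: f - f`_nf *: (h * 'X^(nf - ng)).
have coef_f' i : f'`_i = g`_0 * f`_i
    - f`_nf * (if (i < nf - ng)%N then 0 else h`_(i - (nf - ng))).
  by rewrite coefB !coefZ coefMXn.
have idP a b : b \in (P : prime_idealr R) -> a * b \in (P : prime_idealr R).
  exact: idealMr.
have f'P i : f'`_i - g`_0 * f`_i \in (P : prime_idealr R).
  by rewrite coef_f' addrC addKr rpredN mulrC idP // fP.
apply: (IHn x f' g) => //.
- apply: leq_trans szn; rewrite szg ltn_add2r ltnS.
  apply/leq_sizeP => i le_nfi; rewrite coef_f' ltnNge.
  have -> : (nf - ng <= i)%N by rewrite (leq_trans (leq_subr _ _)).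
  rewrite coef_poly /=; have [->|ne_inf] := eqVneq i nf.
    by rewrite subKn // ltnSn subnn mulrC subrr.
  have lt_nfi : (nf < i)%N by rewrite ltn_neqAle eq_sym ne_inf.
  have -> : f`_i = 0 by rewrite nth_default // szf.
  by rewrite ltnS leqNgt ltn_subRL subnK // lt_nfi /= !mulr0 subr0.
- rewrite /f' rmorphB /= !map_polyZ rmorphM /= hornerD hornerN !hornerZ.
  by rewrite hornerM fx hx mul0r !mulr0 subr0.
- apply: contra f0 => f'0; have := f'P 0%N.
  rewrite rpredBl // (prime_idealrM (P : prime_idealr R)).
  by rewrite (negPf g0).
- by move=> i /fP fi; rewrite -[f'`_i](subrK (g`_0 * f`_i)) rpredD // idP.
Qed.

(** Write R[x] as a ring of quotients R_S and x = r / s with s in S.  Either s is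
    outside P, or 1/s = f(x) for some f over R, and then x is a root of 1 - s f. *)
Lemma qr_denominator_or_root P x : qr_domain R ->
  (exists2 t, t \notin (P : prime_idealr R) & exists r, t%:F * x = r%:F) \/
  exists f, [/\ ev x f = 0, f`_0 \notin (P : prime_idealr R)
    & forall i, (0 < i)%N -> f`_i \in (P : prime_idealr R)].
Proof.
move=> qrR; have [|S [[S1 SM] S0 TS]] := qrR (range (fun f => ev x f)).
  split=> [|_ [r _ <-]]; last first.
    by exists r%:P => //; rewrite map_polyC hornerC.
  split=> [|y z|y z]; rewrite !inE.
  - by exists 1 => //; rewrite rmorph1 hornerC.
  - by move=> [f _ <-] [g _ <-]; exists (f - g) => //; rewrite rmorphB hornerD hornerN.
  - by move=> [f _ <-] [g _ <-]; exists (f * g) => //; rewrite rmorphM hornerM.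
have s0 s : S s -> s%:F != 0.
  by move=> Ss; rewrite tofrac_eq0; apply/eqP => s0; apply: S0; rewrite -s0.
have [r _ [s Ss sx]] : localization S x.
  by rewrite -TS; exists 'X => //; rewrite map_polyX hornerX.
have [sP|sP] := boolP (s \in (P : prime_idealr R)); last first.
  left; exists s => //; exists r; rewrite -sx.
  by rewrite mulrC divfK // s0.
right; have [f _ fs] : range (fun f => ev x f) s%:F^-1.
  by rewrite TS; exists 1 => //; exists s => //; rewrite rmorph1 mul1r.
exists (1 - s *: f); split.
- rewrite rmorphB rmorph1 /= map_polyZ hornerD hornerN hornerZ fs hornerC.
  by rewrite divff ?s0 // subrr.
- rewrite coefB coef1 coefZ rpredBr ?(idealr1 (P : prime_idealr R)) //.
  by rewrite mulrC idealMr.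
- move=> i i_gt0; rewrite coefB coef1 coefZ gtn_eqF // sub0r rpredN.
  by rewrite mulrC idealMr.
Qed.

Lemma qr_comaximal_denominators : qr_domain R -> comaximal_denominators.
Proof.
move=> qrR x.
pose I : set R := [set z | exists p q c d : R,
  [/\ p%:F * x = c%:F, q%:F * x = d%:F & z = c + q]].
have ringR := subring_setT R.
(* the property at x says that this ideal of sums p x + q contains 1 *)
have idI : ideal_of setT I.
  split=> //; split.
  - by exists 0, 0, 0, 0; rewrite rmorph0 mul0r addr0.
  - move=> _ _ [p [q [c [d [pc qd ->]]]]] [p' [q' [c' [d' [pc' qd' ->]]]]].
    exists (p + p'), (q + q'), (c + c'), (d + d').
    by rewrite !tofracD !mulrDl pc qd pc' qd' addrACA.
  - move=> b _ _ [p [q [c [d [pc qd ->]]]]].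
    exists (b * p), (b * q), (b * c), (b * d).
    by rewrite !tofracM -!mulrA pc qd mulrDr.
have [[p [q [c [d [pc qd ->]]]]]|I1] := pselect (I 1).
  by exists p, q, d; rewrite addrK.
exfalso; have [M maxM IM] := exists_maximal_ideal ringR idI I1.
have [|P PM] := contraction_maximal_ideal ringR (phi := idfun) _ maxM; first by [].
have IP z : I z -> z \in (P : prime_idealr R) by move=> /IM Mz; apply/PM.
have x0 : x != 0.
  apply: contra_notN I1 => /eqP x0; exists 0, 1, 0, 0.
  by rewrite x0 !mulr0 rmorph0 add0r.
have [[t tP [r tr]]|[f [fx f0 fP]]] := qr_denominator_or_root P x qrR.
  case/negP: tP; apply: IP; exists 0, t, 0, r.
  by rewrite rmorph0 mul0r add0r.
have [[t tP [r tr]]|[g [gx g0 gP]]] := qr_denominator_or_root P x^-1 qrR.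
  case/negP: tP; apply: IP; exists r, 0, t, 0.
  by rewrite rmorph0 mul0r addr0 -tr mulfVK.
exact: (no_dual_roots x0 fx gx f0 fP g0 gP).
Qed.

(** * Radicals of finitely generated ideals in QR-domains *)

(** The ring T = R_a ∩ R_b contains u = p / b and v = q / b for the p, q attached
    to a / b, and u a + v b = 1.  As T = R_S, u and v have denominators s, t in
    S; then s t is in (a, b), and 1/(s t) is in T. *)
Lemma qr_radical_principal2 (a b : R) : qr_domain R ->
  exists s c d u v : R, exists n,
    [/\ s = c * a + d * b, a ^+ n = u * s & b ^+ n = v * s].
Proof.
move=> qrR; have [->|b0] := eqVneq b 0.
  by exists a, 1, 0, 1, 0, 1%N; rewrite !mul1r !mul0r addr0 !expr1.
have Fb0 : b%:F != 0 by rewrite tofrac_eq0.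
have [p [q [r [px qx]]]] := qr_comaximal_denominators qrR (a%:F / b%:F).
pose isR := range (@FracField.tofrac R).
have isRF c : isR c%:F by exists c.
have isRM y z : isR y -> isR z -> isR (y * z).
  by move=> [c _ <-] [d _ <-]; exists (c * d) => //; rewrite tofracM.
have isRB y z : isR y -> isR z -> isR (y - z).
  by move=> [c _ <-] [d _ <-]; exists (c - d) => //; rewrite tofracB.
pose T : set K := [set y | exists n, isR ((a ^+ n)%:F * y) /\ isR ((b ^+ n)%:F * y)].
have ovT : overring T.
  split=> [|_ [c _ <-]]; last by exists 0%N; split; apply: isRM.
  split=> [|y z|y z]; rewrite !inE.
  - by exists 0%N; rewrite mulr1; split.
  - move=> [m [ya yb]] [n [za zb]]; exists (n + m)%N.
    have clear_denominators (c : R) : isR ((c ^+ m)%:F * y) ->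
        isR ((c ^+ n)%:F * z) -> isR ((c ^+ (n + m))%:F * (y - z)).
      move=> cy cz; rewrite mulrBr [in X in X - _]exprD addnC exprD !tofracM.
      by rewrite -!mulrA; apply: isRB; apply: isRM.
    by split; exact: clear_denominators.
  - move=> [m [ya yb]] [n [za zb]]; exists (m + n)%N.
    by rewrite !exprD !tofracM; split; rewrite mulrACA; exact: isRM.
have [S [[S1 SM] S0 TS]] := qrR T ovT.
have s0 s : S s -> s%:F != 0.
  by move=> Ss; rewrite tofrac_eq0; apply/eqP => s0; apply: S0; rewrite -s0.
have [c _ [s Ss cs]] : localization S (p%:F / b%:F).
  rewrite -TS; exists 1%N; rewrite !expr1; split.
    by rewrite mulrCA px.
  by rewrite mulrC divfK.
have [d _ [t St dt]] : localization S (q%:F / b%:F).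
  rewrite -TS; exists 1%N; rewrite !expr1; split.
    by rewrite mulrCA qx.
  by rewrite mulrC divfK.
have Sst : S (s * t).
  by have := SM s t; rewrite !inE; exact.
have [n [[u _ ua] [v _ vb]]] : T (s * t)%:F^-1.
  by rewrite TS; exists 1 => //; exists (s * t) => //; rewrite rmorph1 mul1r.
exists (s * t), (c * t), (d * s), u, v, n; split.
- apply/eqP; rewrite -tofrac_eq; apply/eqP.
  have cE : c%:F = p%:F / b%:F * s%:F by rewrite -cs divfK ?s0.
  have dE : d%:F = q%:F / b%:F * t%:F by rewrite -dt divfK ?s0.
  rewrite tofracD !tofracM cE dE.
  transitivity ((p%:F * (a%:F / b%:F) + q%:F * (b%:F / b%:F)) * (s%:F * t%:F)).
    by rewrite px divff // mulr1 -tofracD subrK tofrac1 mul1r.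
  rewrite mulrDl -!mulrA; congr (_ + _); congr (_ * _).
    by rewrite mulrCA; congr (_ * _); rewrite mulrCA; congr (_ * _); rewrite mulrC.
  rewrite mulrCA; congr (_ * _); rewrite mulrCA [RHS]mulrCA; congr (_ * _).
  by rewrite mulrC.
- apply/eqP; rewrite -tofrac_eq tofracM ua -mulrA mulVf ?s0 ?mulr1 //.
- apply/eqP; rewrite -tofrac_eq tofracM vb -mulrA mulVf ?s0 ?mulr1 //.
Qed.

(** Induction on the number of elements reduces to two of them. *)
Lemma qr_radical_principal (I : set R) (s : seq R) : qr_domain R ->
  ideal_of setT I -> (forall y, y \in s -> I y) ->
  exists2 z, I z & forall P, z \in (P : prime_idealr R) ->
    forall y, y \in s -> y \in (P : prime_idealr R).
Proof.
move=> qrR [_ [I0 ID IM]]; elim: s => [|a s IHs] sI; first by exists 0.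
have [x xs|z Iz zP] := IHs; first by apply: sI; rewrite inE xs orbT.
have [w [c [d [u [v [n [wE aw zw]]]]]]] := qr_radical_principal2 a z qrR.
exists w => [|P wP x].
  by rewrite wE; apply: ID; apply: IM => //; exact/sI/mem_head.
have powP y k : y ^+ k \in (P : prime_idealr R) -> y \in (P : prime_idealr R).
  elim: k => [|k IHk]; first by rewrite expr0 (idealr1 (P : prime_idealr R)).
  by rewrite exprS (prime_idealrM (P : prime_idealr R)) => /orP[].
rewrite inE => /predU1P[->|/zP]; first by apply: (powP _ n); rewrite aw idealMr.
by apply; apply: (powP _ n); rewrite zw idealMr.
Qed.

End Fractions.

(** * Prime avoidance and compactness *)

(** The ideal generated by a set E in no prime of A has by prime avoidance an
    element outside all of them; the finitely many elements of E it involves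
    witness compactness. *)
Lemma PA_property_compact (R : comNzRingType) (A : set (Spec R)) :
  PA_property A -> cover_compact A.
Proof.
move=> paA; apply/cover_compactP => E EA.
have ringR := subring_setT R.
pose I := mulset [set idfun r | r in E] setT.
have idI : ideal_of setT I by exact: mulset_ideal.
have [] := pselect (I `<=` \bigcup_(P in A) [set` (P : prime_idealr R)]).
  move=> /(paA I idI)[P AP IP]; case: (EA P AP) => r Er.
  by apply: IP; apply: mem_mulset => //; exists r.
move=> /existsNP[x /not_implyP[/mulset_finite[s sE sx] xA]].
exists s => // P AP; apply: contrapT => sP; apply: xA; exists P => //.
apply: mulset_min sx => [|_ [r /= rs <-]].
  split=> [|y z|b y _] /=; first exact: (idealr0 (P : prime_idealr R)).
    by move=> yP zP; exact: (rpredD yP zP).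
  exact: idealMr.
by apply: contrapT => /negP rP; apply: sP; exists r.
Qed.

(** Compactness yields finitely many elements of I, not all in any prime of A;
    one element of I has the same property by the radical lemma. *)
Lemma qr_compact_PA_property (R : idomainType) (A : set (Spec R)) :
  qr_domain R -> cover_compact A -> PA_property A.
Proof.
move=> qrR /cover_compactP cA I idI IA; apply: contrapT => nI.
have [P AP IP|s sI sA] := cA I; first by apply: nI; exists P.
have [z Iz zP] := qr_radical_principal qrR idI sI.
have [P AP /zP sP] := IA z Iz.
by have [x /sP ->] := sA P AP.
Qed.

Theorem theorem2p12 :
  (forall (R : idomainType) (T : set {fraction R}),
     prufer_domain R -> overring T ->
     cover_compact [set P : Spec R | maximal_ideal_of T (extension T P)]) /\
  (forall R : idomainType,
     prufer_domain R -> ~ qr_domain R ->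
     exists A : set (Spec R), cover_compact A /\ ~ PA_property A) /\
  (forall (R : idomainType) (A : set (Spec R)),
     qr_domain R -> (PA_property A <-> cover_compact A)).
Proof.
split=> [R T /prufer_comaximal_denominators|].
  exact: contracted_maximal_compact.
split=> [R /prufer_comaximal_denominators cmR|R A qrR].
  move=> /existsNP[T /not_implyP[ovT nT]].
  exists [set P : Spec R | maximal_ideal_of T (extension T P)].
  split; first exact: contracted_maximal_compact.
  by move=> /(PA_property_localization cmR ovT).
by split; [exact: PA_property_compact|exact: qr_compact_PA_property].
Qed.
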